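(* Let $X,Y$ be real Hilbert spaces, $\mathcal{G}:X\to Y$ a (possibly nonlinear) map, $\Gamma$ the noise covariance operator on $Y$, $J\ge1$ an integer and $\psi^{(1)},\dots,\psi^{(J)}\in X$ an initial ensemble, with $\mathcal{A}=\mathrm{span}\{\psi^{(j)}\}_{j=1}^J\subset X$. Let $u^\dagger\in X$ (the truth), $\eta^\dagger\in Y$, and let the data be $y=\mathcal{G}(u^\dagger)+\eta^\dagger$. Let $u_n\in X$ be the estimate at step $n$ produced from the data $y$ by the iterative ensemble Kalman method (defined in the context) started from $\{\psi^{(j)}\}_{j=1}^J$. Then for every $n\in\mathbb{N}=\{0,1,2,\dots\}$, $$\|u_n-u^\dagger\|\ \ge\ \inf_{v\in\mathcal{A}}\|v-u^\dagger\|,$$ where $\|\cdot\|$ is the norm of $X$.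
   Context: Notation. $Z=X\times Y$; elements are written $z=(u,p)$ with $u\in X$, $p\in Y$. The maps $H:Z\to Y$ and $H^\perp:Z\to X$ are the projections $H(u,p)=p$ and $H^\perp(u,p)=u$; $H^T:Y\to Z$ is the adjoint of $H$. For elements $a,b$ of Hilbert spaces, $ab^T$ denotes the rank-one operator $c\mapsto\langle b,c\rangle a$. The map $\Xi:Z\to Z$ is $\Xi(u,p)=(u,\mathcal{G}(u))$. $\Gamma$ is a self-adjoint, nonnegative bounded operator on $Y$ such that the inverses appearing below exist as bounded operators on $Y$. Iterative ensemble Kalman method. Initialise $z_0^{(j)}=(\psi^{(j)},\mathcal{G}(\psi^{(j)}))\in Z$, $j=1,\dots,J$. For $n=0,1,2,\dots$: (1) Prediction step: set $\widehat z_{n+1}^{(j)}=\Xi(z_n^{(j)})$ for $j=1,\dots,J$, and $$\overline z_{n+1}=\frac1J\sum_{j=1}^J\widehat z_{n+1}^{(j)},\qquad C_{n+1}=\frac1J\sum_{j=1}^J\widehat z_{n+1}^{(j)}(\widehat z_{n+1}^{(j)})^T-\overline z_{n+1}\overline z_{n+1}^T .$$ (2) Analysis step: set $K_{n+1}=C_{n+1}H^T(HC_{n+1}H^T+\Gamma)^{-1}$ and, for $j=1,\dots,J$, $$z_{n+1}^{(j)}=\widehat z_{n+1}^{(j)}+K_{n+1}\bigl(y_{n+1}^{(j)}-H\widehat z_{n+1}^{(j)}\bigr),\qquad y_{n+1}^{(j)}=y+\eta_{n+1}^{(j)},$$ where $\eta_{n+1}^{(j)}\in Y$ are realizations of i.i.d.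 (over $(j,n)$) random vectors with distribution $N(0,\Gamma)$. The assertion is for every realization of these vectors. (3) The parameter component of the $j$-th member is $u_n^{(j)}=H^\perp z_n^{(j)}$ (so $u_0^{(j)}=\psi^{(j)}$), and the parameter estimate at step $n$ is $u_n=\frac1J\sum_{j=1}^J u_n^{(j)}$. *)

(* Defs.v *)
From HB Require Import structures.
From mathcomp Require Import all_boot all_order all_algebra.
From mathcomp Require Import all_classical all_reals all_analysis.
Import Order.TTheory GRing.Theory Num.Theory.

Set Implicit Arguments.
Unset Strict Implicit.
Unset Printing Implicit Defensive.

Local Open Scope classical_set_scope.
Local Open Scope ring_scope.

HB.mixin Record Lmodule_hasInner (R : realType) V of GRing.Lmodule R V := {
  inner : V -> V -> R ;
  innerC : forall u v, inner u v = inner v u ;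
  inner_linearl : forall v, GRing.linear_for *%R (inner ^~ v) ;
  inner_gt0 : forall u, u != 0 -> 0 < inner u u
}.

#[short(type="innerProdType")]
HB.structure Definition InnerProd (R : realType) :=
  { V of GRing.Lmodule R V & Lmodule_hasInner R V }.

(* Makes the theory of {dot V for idfun} available for inner. *)
Fact inner_bilinear (R : realType) (V : innerProdType R) :
  bilinear_for *%R (idfun \; *%R) (@inner R V).
Proof.
split=> [v|u]; first exact: inner_linearl.
by move=> a v w; rewrite !(innerC u) inner_linearl.
Qed.

HB.instance Definition _ (R : realType) (V : innerProdType R) :=
  bilinear_isBilinear.Build R V V R *%R (idfun \; *%R) (@inner R V)
    (@inner_bilinear R V).

Fact inner_hermitian (R : realType) (V : innerProdType R) (u v : V) :
  inner u v = (-1) ^+ false * idfun (inner v u).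
Proof. by rewrite mul1r innerC. Qed.

HB.instance Definition _ (R : realType) (V : innerProdType R) :=
  isHermitianSesquilinear.Build R V false idfun (@inner R V)
    (@inner_hermitian R V).

HB.instance Definition _ (R : realType) (V : innerProdType R) :=
  isDotProduct.Build R V (@inner R V) (@inner_gt0 R V).

HB.mixin Record InnerProd_isHilbert (R : realType) V
    of InnerProd R V & CompleteNormedModule R V := {
  norm_inner : forall u : V, `|u| = Num.sqrt (inner u u)
}.

#[short(type="hilbertType")]
HB.structure Definition Hilbert (R : realType) :=
  { V of InnerProd R V & CompleteNormedModule R V & InnerProd_isHilbert R V }.

(* The Hilbert direct sum. The library norms a product by the maximum of the
   two norms, which is equivalent to the norm of this inner product but not
   equal to it; only the inner product is used on products below. *)
Definition prod_inner (R : realType) (V W : innerProdType R) (a b : V * W) : R :=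
  inner a.1 b.1 + inner a.2 b.2.

Fact prod_innerC (R : realType) (V W : innerProdType R) (a b : V * W) :
  prod_inner a b = prod_inner b a.
Proof. by rewrite /prod_inner innerC [X in _ + X]innerC. Qed.

Fact prod_inner_linearl (R : realType) (V W : innerProdType R) (b : V * W) :
  GRing.linear_for *%R ((@prod_inner R V W) ^~ b).
Proof.
by move=> k a c; rewrite /prod_inner /= !inner_linearl mulrDr addrACA.
Qed.

Fact inner_ge0 (R : realType) (V : innerProdType R) (u : V) : 0 <= inner u u.
Proof.
by have [->|/inner_gt0/ltW//] := eqVneq u 0; rewrite linear0r.
Qed.

Fact prod_inner_gt0 (R : realType) (V W : innerProdType R) (a : V * W) :
  a != 0 -> 0 < prod_inner a a.
Proof.
case: a => v w; rewrite /prod_inner /= => vw0.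
have [v0|v0] := eqVneq v 0; last by rewrite ltr_wpDr ?inner_ge0 ?inner_gt0.
rewrite ltr_wpDl ?inner_ge0 ?inner_gt0//.
by apply: contra_neq vw0 => ->; rewrite v0.
Qed.

HB.instance Definition _ (R : realType) (V W : innerProdType R) :=
  Lmodule_hasInner.Build R (V * W)%type
    (@prod_innerC R V W) (@prod_inner_linearl R V W) (@prod_inner_gt0 R V W).

Definition rank_one (R : realType) (V W : innerProdType R) (a : W) (b : V) :
  V -> W := fun c => inner b c *: a.

(* Riesz representative of inner (A _) w; 0 if there is none. *)
Definition adjoint (R : realType) (V W : innerProdType R) (A : V -> W) :
  W -> V := fun w => xget 0 [set v | forall x, inner (A x) w = inner x v].

Definition bounded_operator (R : realType) (V W : normedModType R)
    (A : V -> W) : Prop :=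
  linear A /\ exists M : R, forall v, `|A v| <= M * `|v|.

Definition bounded_inverse (R : realType) (V : normedModType R)
    (A B : V -> V) : Prop :=
  [/\ bounded_operator B, cancel A B & cancel B A].

Definition boundedly_invertible (R : realType) (V : normedModType R)
    (A : V -> V) : Prop := exists B, bounded_inverse A B.

(* Total function; meaningful when A is bijective, see op_invE. *)
Definition op_inv (R : realType) (V : normedModType R) (A : V -> V) : V -> V :=
  fun w => xget 0 [set v | A v = w].

Lemma op_invE (R : realType) (V : normedModType R) (A B : V -> V) :
  bounded_inverse A B -> op_inv A = B.
Proof.
case=> _ AK BK; apply/funext => w; rewrite /op_inv.
by case: xgetP => [v _ /= <-|/(_ (B w))]; rewrite ?AK //= BK.
Qed.

(* Noise covariance as far as it enters the pathwise algorithm. *)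
Definition covariance_operator (R : realType) (V : hilbertType R)
    (Gamma : V -> V) : Prop :=
  [/\ bounded_operator Gamma,
      forall p q, inner (Gamma p) q = inner p (Gamma q) &
      forall p, 0 <= inner (Gamma p) p].

Definition lin_span (R : realType) (V : lmodType R) (J : nat) (psi : 'I_J -> V) :
  set V := [set \sum_(j < J) a j *: psi j | a in [set: 'I_J -> R]].

Definition ens_mean (R : realType) (V : lmodType R) (J : nat) (v : 'I_J -> V) : V :=
  J%:R^-1 *: \sum_(j < J) v j.

Definition sample_cov (R : realType) (V : innerProdType R) (J : nat)
    (v : 'I_J -> V) : V -> V :=
  fun c => J%:R^-1 *: \sum_(j < J) rank_one (v j) (v j) c
           - rank_one (ens_mean v) (ens_mean v) c.

Definition Hproj {X Y : Type} (z : X * Y) : Y := z.2.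
Definition Hperp {X Y : Type} (z : X * Y) : X := z.1.

Lemma adjoint_HprojE (R : realType) (X Y : innerProdType R) (p : Y) :
  adjoint (@Hproj X Y) p = (0, p).
Proof.
have H0 z : inner (Hproj z) p = inner z ((0, p) : X * Y).
  rewrite [RHS]/(prod_inner _ _) /prod_inner /Hproj /=.
  by rewrite linear0r add0r.
rewrite /adjoint; case: xgetP => [v _ /= vP|/(_ (0, p))//].
apply/eqP; rewrite -subr_eq0; apply: contraT => /inner_gt0.
by rewrite linearBr /= -vP -H0 subrr ltxx.
Qed.

Definition Xi {X Y : Type} (G : X -> Y) (z : X * Y) : X * Y := (z.1, G z.1).

(* H C H^T + Gamma *)
Definition innovation_cov (R : realType) (X Y : hilbertType R)
    (Gamma : Y -> Y) (C : X * Y -> X * Y) : Y -> Y :=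
  fun p => Hproj (C (adjoint (@Hproj X Y) p)) + Gamma p.

(* K = C H^T (H C H^T + Gamma)^-1 *)
Definition kalman_gain (R : realType) (X Y : hilbertType R)
    (Gamma : Y -> Y) (C : X * Y -> X * Y) : Y -> X * Y :=
  fun p => C (adjoint (@Hproj X Y) (op_inv (innovation_cov Gamma C) p)).

(* eta holds the perturbations of the step being performed, z the ensemble
   before it. *)
Definition enkf_step (R : realType) (X Y : hilbertType R) (G : X -> Y)
    (Gamma : Y -> Y) (y : Y) (J : nat) (eta : 'I_J -> Y) (z : 'I_J -> X * Y) :
  'I_J -> X * Y :=
  let zhat j := Xi G (z j) in
  let K := kalman_gain Gamma (sample_cov zhat) in
  fun j => zhat j + K (y + eta j - Hproj (zhat j)).

(* eta n j is the perturbation at step n >= 1; eta 0 is not used. *)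
Fixpoint enkf (R : realType) (X Y : hilbertType R) (G : X -> Y)
    (Gamma : Y -> Y) (y : Y) (J : nat) (psi : 'I_J -> X)
    (eta : nat -> 'I_J -> Y) (n : nat) : 'I_J -> X * Y :=
  if n is m.+1 then
    enkf_step G Gamma y (eta m.+1) (enkf G Gamma y psi eta m)
  else fun j => (psi j, G (psi j)).

(* C_(n+1), from the predictions at step n+1. *)
Definition enkf_cov (R : realType) (X Y : hilbertType R) (G : X -> Y)
    (Gamma : Y -> Y) (y : Y) (J : nat) (psi : 'I_J -> X)
    (eta : nat -> 'I_J -> Y) (n : nat) : X * Y -> X * Y :=
  sample_cov (fun j => Xi G (enkf G Gamma y psi eta n j)).

Definition enkf_estimate (R : realType) (X Y : hilbertType R) (G : X -> Y)
    (Gamma : Y -> Y) (y : Y) (J : nat) (psi : 'I_J -> X)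
    (eta : nat -> 'I_J -> Y) (n : nat) : X :=
  ens_mean (fun j => Hperp (enkf G Gamma y psi eta n j)).

(* Main.v *)
(* Every correction applied to an ensemble member lies in the range of the
   empirical covariance, hence its X-component is a combination of the
   X-components of the members: the ensemble never leaves the span of the
   initial one. *)
Require Import Defs.
From HB Require Import structures.
From mathcomp Require Import all_boot all_order all_algebra.
From mathcomp Require Import all_classical all_reals all_analysis.
Import Order.TTheory GRing.Theory Num.Theory.

Local Open Scope classical_set_scope.
Local Open Scope ring_scope.

Lemma lin_span_gen (R : realType) (V : lmodType R) (J : nat) (psi : 'I_J -> V)
    (j : 'I_J) :
  lin_span psi (psi j).
Proof.
exists (fun i => (i == j)%:R) => //.
rewrite (bigD1 j) //= eqxx scale1r big1 ?addr0// => i /negPf ->.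
by rewrite scale0r.
Qed.

Lemma lin_span0 (R : realType) (V : lmodType R) (J : nat) (psi : 'I_J -> V) :
  lin_span psi 0.
Proof. by exists (fun=> 0) => //; rewrite big1// => j _; rewrite scale0r. Qed.

Lemma lin_spanD (R : realType) (V : lmodType R) (J : nat) (psi : 'I_J -> V)
    (u v : V) :
  lin_span psi u -> lin_span psi v -> lin_span psi (u + v).
Proof.
move=> [a _ <-] [b _ <-]; exists (fun j => a j + b j) => //.
by rewrite -big_split; apply: eq_bigr => j _; rewrite scalerDl.
Qed.

Lemma lin_spanZ (R : realType) (V : lmodType R) (J : nat) (psi : 'I_J -> V)
    (k : R) (u : V) :
  lin_span psi u -> lin_span psi (k *: u).
Proof.
move=> [a _ <-]; exists (fun j => k * a j) => //.
by rewrite scaler_sumr; apply: eq_bigr => j _; rewrite scalerA.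
Qed.

Lemma lin_spanB (R : realType) (V : lmodType R) (J : nat) (psi : 'I_J -> V)
    (u v : V) :
  lin_span psi u -> lin_span psi v -> lin_span psi (u - v).
Proof.
by move=> uS vS; rewrite -scaleN1r; apply: lin_spanD => //; exact: lin_spanZ.
Qed.

Lemma lin_span_sum (R : realType) (V : lmodType R) (J : nat) (psi : 'I_J -> V)
    (m : nat) (v : 'I_m -> V) :
  (forall i, lin_span psi (v i)) -> lin_span psi (\sum_i v i).
Proof.
move=> vS; elim/big_ind: _ => [|u w|i _]; last exact: vS.
- exact: lin_span0.
- exact: lin_spanD.
Qed.

Lemma lin_span_mean (R : realType) (V : lmodType R) (J : nat) (psi : 'I_J -> V)
    (m : nat) (v : 'I_m -> V) :
  (forall i, lin_span psi (v i)) -> lin_span psi (ens_mean v).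
Proof. by move=> vS; apply/lin_spanZ/lin_span_sum. Qed.

(** Each rank-one term sends [c] to a scalar multiple of a member or of the mean, so only the
    coefficients depend on [c]. The result thus applies to whatever vector the Kalman gain feeds to
    the covariance. *)
Lemma fst_sample_cov_lin_span (R : realType) (X Y : innerProdType R) (J : nat)
    (psi : 'I_J -> X) (m : nat) (z : 'I_m -> X * Y) (c : X * Y) :
  (forall i, lin_span psi (z i).1) -> lin_span psi (sample_cov z c).1.
Proof.
move=> zS; rewrite /sample_cov /rank_one /ens_mean /=.
apply: lin_spanB; do ?apply: lin_spanZ.
  (* The first projection is additive, so it passes through the sum over members. *)
  by rewrite raddf_sum; apply: lin_span_sum => i; exact: lin_spanZ.
by rewrite raddf_sum; exact: lin_span_sum.
Qed.

Lemma fst_enkf_lin_span (R : realType) (X Y : hilbertType R) (G : X -> Y)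
    (Gamma : Y -> Y) (y : Y) (J : nat) (psi : 'I_J -> X)
    (eta : nat -> 'I_J -> Y) (n : nat) (j : 'I_J) :
  lin_span psi (enkf G Gamma y psi eta n j).1.
Proof.
elim: n j => [|n IHn] j; first exact: lin_span_gen.
(* By conversion, [Xi] keeps the parameter component, and the gain term is [sample_cov] of the
   predictions applied to some vector. *)
by apply: lin_spanD; [exact: IHn | exact: fst_sample_cov_lin_span].
Qed.

Theorem corollary2p3 (R : realType) (X Y : hilbertType R) (G : X -> Y)
    (Gamma : Y -> Y) (J : nat) (psi : 'I_J -> X)
    (udagger : X) (etadagger y : Y) (eta : nat -> 'I_J -> Y)
    (J_ge1 : (1 <= J)%N)
    (Gamma_cov : covariance_operator Gamma)
    (y_data : y = G udagger + etadagger)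
    (inverses : forall n, boundedly_invertible
       (innovation_cov Gamma (enkf_cov G Gamma y psi eta n)))
    (n : nat) :
  inf [set `|v - udagger| | v in lin_span psi]
    <= `|enkf_estimate G Gamma y psi eta n - udagger|.
Proof.
(* An infimum lies below each element once the set is bounded below; norms give the bound 0. *)
apply: ge_inf; first by exists 0 => _ [v _ <-].
(* The estimate is itself a competitor in the infimum, being a mean of members in the span. *)
exists (enkf_estimate G Gamma y psi eta n) => //.
by apply: lin_span_mean => j; exact: fst_enkf_lin_span.
Qed.
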